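(* Let the problem data, the weights $a_j^i(k)$ and the coefficients $c(k)$ satisfy Assumptions (Convexity), (Compactness), (Slater), (Coefficient), (Weights) and (Connectivity) stated in the context, let $\lambda_i(k)$ and $\ell_i(k)$, $i=1,\dots,m$, $k\ge 0$, be generated by the algorithm described in the context, and let $v(k)=\frac1m\sum_{i=1}^m\lambda_i(k)$. Then $$\sum_{k=1}^\infty c(k)\sum_{i=1}^m\big|\varphi_i(\ell_i(k))-\varphi_i(v(k))\big|<\infty .$$
   Context: Notation. $\|\cdot\|$ is the Euclidean norm; $\mathbb{R}^p_+$ is the non-negative orthant of $\mathbb{R}^p$ ($\lambda\ge 0$ means $\lambda\in\mathbb{R}^p_+$); vector inequalities are component-wise; $\operatorname{relint}$ is relative interior. Problem. There are $m$ agents. Agent $i$ has a set $X_i\subseteq\mathbb{R}^{n_i}$ and functions $f_i:\mathbb{R}^{n_i}\to\mathbb{R}$, $g_i:\mathbb{R}^{n_i}\to\mathbb{R}^p$. Let $n=\sum_i n_i$, $X=X_1\times\cdots\times X_m\subseteq\mathbb{R}^n$, $x=(x_1,\dots,x_m)$. The primal problem is: minimize $\sum_{i=1}^m f_i(x_i)$ over $x\in X$ subject to $\sum_{i=1}^m g_i(x_i)\le 0$. The dual function of agent $i$ is $\varphi_i(\lambda)=\min_{x_i\in X_i}\{f_i(x_i)+\lambda^\top g_i(x_i)\}$, $\lambda\in\mathbb{R}^p_+$. Algorithm. Take any $\hat x_i(0)\in X_i$ and $\lambda_i(0)\in\mathbb{R}^p_+$, $i=1,\dots,m$. For $k=0,1,2,\dots$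 and each $i$: - $\ell_i(k)=\sum_{j=1}^m a_j^i(k)\lambda_j(k)$; - $x_i(k+1)\in\arg\min_{x_i\in X_i}\{f_i(x_i)+\ell_i(k)^\top g_i(x_i)\}$ (any minimizer); - $\lambda_i(k+1)=\arg\max_{\lambda_i\ge 0}\{g_i(x_i(k+1))^\top\lambda_i-\frac{1}{2c(k)}\|\lambda_i-\ell_i(k)\|^2\}$; - $\hat x_i(k+1)=\hat x_i(k)+\frac{c(k)}{\sum_{r=0}^k c(r)}(x_i(k+1)-\hat x_i(k))$. Assumptions. (Convexity) For each $i$, $f_i$ and each component of $g_i$ are convex on $\mathbb{R}^{n_i}$, and $X_i$ is convex. (Compactness) Each $X_i$ is compact. (Slater) There exists $\tilde x=(\tilde x_1,\dots,\tilde x_m)\in\operatorname{relint}(X)$ such that $\sum_{i=1}^m g_i(\tilde x_i)\le 0$ for those components of $\sum_{i=1}^m g_i(x_i)$ that are linear (i.e. affine) in $x$, if any, while $\sum_{i=1}^m g_i(\tilde x_i)<0$ for all other components. (Coefficient) $\{c(k)\}_{k\ge 0}$ is a non-increasing sequence of positive reals with $\sum_{k=0}^\infty c(k)=\infty$ and $\sum_{k=0}^\infty c(k)^2<\infty$. (Weights) There exists $\eta\in(0,1)$ such that for all $i,j\in\{1,\dots,m\}$ and all $k\ge 0$: $a_j^i(k)\in[0,1)$, $a_i^i(k)\ge\eta$, and $a_j^i(k)>0$ implies $a_j^i(k)\ge\eta$. Moreover, for all $k\ge 0$, $\sum_{j=1}^m a_j^i(k)=1$ for all $i$ and $\sum_{i=1}^m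 a_j^i(k)=1$ for all $j$. (Connectivity) Let $V=\{1,\dots,m\}$, $E_k=\{(j,i): a_j^i(k)>0\}$ and $E_\infty=\{(j,i):(j,i)\in E_k\text{ for infinitely many }k\}$. The directed graph $(V,E_\infty)$ is strongly connected, and there exists $T\ge 1$ such that for every $(j,i)\in E_\infty$, agent $i$ receives information from agent $j$ at least once every $T$ consecutive iterations, i.e. for every $k\ge0$, $(j,i)\in E_k\cup E_{k+1}\cup\dots\cup E_{k+T-1}$. *)

(* Defs.v *)
From HB Require Import structures.
From mathcomp Require Import all_boot all_order all_algebra.
From mathcomp Require Import all_classical all_reals all_analysis.
Set Implicit Arguments.
Unset Strict Implicit.
Unset Printing Implicit Defensive.
Import Order.TTheory GRing.Theory Num.Theory.
Import numFieldNormedType.Exports.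
Local Open Scope classical_set_scope.
Local Open Scope ring_scope.

(* Vectors of R^q are row vectors 'rV[R]_q.  The norm that the library puts on
   'rV[R]_q is the sup norm, hence the explicit Euclidean norm [enorm]; the
   topology (used in [compact] and [\near]) is the same for both norms. *)
Definition dot (R : realType) (q : nat) (u v : 'rV[R]_q) : R :=
  \sum_(j < q) u ord0 j * v ord0 j.

Definition enorm (R : realType) (q : nat) (u : 'rV[R]_q) : R :=
  Num.sqrt (dot u u).

Definition nneg_orthant (R : realType) (q : nat) : set 'rV[R]_q :=
  [set u | forall j, 0 <= u ord0 j].

Definition argmin (R : realType) (T : Type) (A : set T) (h : T -> R) : set T :=
  [set x | A x /\ forall y, A y -> h x <= h y].

Definition argmax (R : realType) (T : Type) (A : set T) (h : T -> R) : set T :=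
  [set x | A x /\ forall y, A y -> h y <= h x].

Definition affine_hull (R : realType) (q : nat) (A : set 'rV[R]_q) :
    set 'rV[R]_q :=
  [set x | exists s (t : 'I_s -> R) (y : 'I_s -> 'rV[R]_q),
     [/\ forall i, A (y i), \sum_(i < s) t i = 1 & x = \sum_(i < s) t i *: y i]].

Definition relint (R : realType) (q : nat) (A : set 'rV[R]_q) : set 'rV[R]_q :=
  [set x | A x /\ \forall y \near x, affine_hull A y -> A y].

Definition affine_function (R : realType) (q : nat) (h : 'rV[R]_q -> R) : Prop :=
  exists (w : 'rV[R]_q) (b : R), forall x, h x = dot w x + b.

(* A point x = (x_1, ..., x_m) of R^n, n = \sum_i n_i, is a single row vector
   whose i-th block [submxrow x i] is x_i. *)
Definition product_set (R : realType) (m : nat) (n : 'I_m -> nat)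
    (X : forall i, set 'rV[R]_(n i)) : set 'rV[R]_(\sum_i n i) :=
  [set x | forall i, X i (submxrow x i)].

Definition coupling (R : realType) (m p : nat) (n : 'I_m -> nat)
    (g : forall i, 'rV[R]_(n i) -> 'rV[R]_p) (x : 'rV[R]_(\sum_i n i)) :
    'rV[R]_p :=
  \sum_i g i (submxrow x i).

Definition lagrangian (R : realType) (q p : nat) (f : 'rV[R]_q -> R)
    (g : 'rV[R]_q -> 'rV[R]_p) (l : 'rV[R]_p) (x : 'rV[R]_q) : R :=
  f x + dot l (g x).

(* [inf] is the minimum whenever the latter is attained, see [dual_fun_min];
   this is the case for X compact and nonempty and f, g convex on the whole
   space, hence continuous. *)
Definition dual_fun (R : realType) (q p : nat) (X : set 'rV[R]_q)
    (f : 'rV[R]_q -> R) (g : 'rV[R]_q -> 'rV[R]_p) (l : 'rV[R]_p) : R :=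
  inf [set lagrangian f g l x | x in X].

Lemma dual_fun_min (R : realType) (q p : nat) (X : set 'rV[R]_q)
    (f : 'rV[R]_q -> R) (g : 'rV[R]_q -> 'rV[R]_p) (l : 'rV[R]_p)
    (x : 'rV[R]_q) :
  argmin X (lagrangian f g l) x -> dual_fun X f g l = lagrangian f g l x.
Proof.
move=> [Xx xmin]; apply/eqP; rewrite eq_le; apply/andP; split.
  by apply: ge_inf; [exists (lagrangian f g l x) => _ [y Xy <-]; exact: xmin
                    | exists x].
by apply: lb_le_inf; [exists (lagrangian f g l x); exists x
                     | move=> _ [y Xy <-]; exact: xmin].
Qed.

Definition convexity_assumption (R : realType) (m p : nat) (n : 'I_m -> nat)
    (X : forall i, set 'rV[R]_(n i)) (f : forall i, 'rV[R]_(n i) -> R)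
    (g : forall i, 'rV[R]_(n i) -> 'rV[R]_p) : Prop :=
  forall i, [/\ convex_function setT (f i),
                forall j, convex_function setT (fun x => g i x ord0 j)
              & convex_set (X i)].

Definition compactness_assumption (R : realType) (m : nat) (n : 'I_m -> nat)
    (X : forall i, set 'rV[R]_(n i)) : Prop :=
  forall i, compact (X i).

Definition slater_assumption (R : realType) (m p : nat) (n : 'I_m -> nat)
    (X : forall i, set 'rV[R]_(n i))
    (g : forall i, 'rV[R]_(n i) -> 'rV[R]_p) : Prop :=
  exists2 xt, relint (product_set X) xt &
    forall j, let h := fun x => coupling g x ord0 j in
      (affine_function h -> h xt <= 0) /\ (~ affine_function h -> h xt < 0).

Definition coefficient_assumption (R : realType) (c : nat -> R) : Prop :=
  [/\ nonincreasing_seq c,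
      forall k, 0 < c k,
      (\sum_(0 <= k <oo) (c k)%:E = +oo)%E
    & (\sum_(0 <= k <oo) (c k ^+ 2)%:E < +oo)%E].

(* [a k i j] is the weight a_j^i(k) that agent i gives to agent j at time k. *)
Definition weights_assumption (R : realType) (m : nat)
    (a : nat -> 'I_m -> 'I_m -> R) : Prop :=
  (exists eta : R, 0 < eta < 1 /\
     forall i j k, [/\ 0 <= a k i j < 1,
                       eta <= a k i i
                     & 0 < a k i j -> eta <= a k i j]) /\
  (forall k, (forall i, \sum_j a k i j = 1) /\ (forall j, \sum_i a k i j = 1)).

(* Agent i receives information from agent j at time k. *)
Definition edge (R : realType) (m : nat) (a : nat -> 'I_m -> 'I_m -> R)
    (k : nat) (j i : 'I_m) : Prop := 0 < a k i j.

Definition edge_inf (R : realType) (m : nat) (a : nat -> 'I_m -> 'I_m -> R)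
    (j i : 'I_m) : Prop :=
  forall N : nat, exists2 k, (N <= k)%N & edge a k j i.

Definition connectivity_assumption (R : realType) (m : nat)
    (a : nat -> 'I_m -> 'I_m -> R) : Prop :=
  (forall j i, connect [rel u v | `[< edge_inf a u v >]] j i) /\
  (exists2 T : nat, (1 <= T)%N &
     forall j i, edge_inf a j i ->
       forall k, exists2 s, (k <= s < k + T)%N & edge a s j i).

(* The local average l_i(k), where lam k j = lambda_j(k). *)
Definition ell (R : realType) (m p : nat) (a : nat -> 'I_m -> 'I_m -> R)
    (lam : nat -> 'I_m -> 'rV[R]_p) (k : nat) (i : 'I_m) : 'rV[R]_p :=
  \sum_j a k i j *: lam k j.

Definition average (R : realType) (m p : nat)
    (lam : nat -> 'I_m -> 'rV[R]_p) (k : nat) : 'rV[R]_p :=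
  m%:R^-1 *: \sum_i lam k i.

(* (x, xhat, lam) is a run of the algorithm.  The algorithm only produces
   x_i(k) for k >= 1, so x 0 is left unconstrained.  The objective maximized by
   lam k.+1 i is strictly concave, so [argmax] has at most one element. *)
Definition algorithm_run (R : realType) (m p : nat) (n : 'I_m -> nat)
    (X : forall i, set 'rV[R]_(n i)) (f : forall i, 'rV[R]_(n i) -> R)
    (g : forall i, 'rV[R]_(n i) -> 'rV[R]_p)
    (a : nat -> 'I_m -> 'I_m -> R) (c : nat -> R)
    (x xhat : nat -> forall i, 'rV[R]_(n i))
    (lam : nat -> 'I_m -> 'rV[R]_p) : Prop :=
  (forall i, X i (xhat 0%N i) /\ nneg_orthant (lam 0%N i)) /\
  (forall k i,
    [/\ argmin (X i) (lagrangian (f i) (g i) (ell a lam k i)) (x k.+1 i),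
        argmax (@nneg_orthant R p)
          (fun l => dot (g i (x k.+1 i)) l
                    - (2 * c k)^-1 * enorm (l - ell a lam k i) ^+ 2)
          (lam k.+1 i)
      & xhat k.+1 i = xhat k i
          + (c k / \sum_(0 <= r < k.+1) c r) *: (x k.+1 i - xhat k i)]).

(* Main.v *)
Require Import Defs.
From HB Require Import structures.
From mathcomp Require Import all_boot all_order all_algebra.
From mathcomp Require Import all_classical all_reals all_analysis.
From mathcomp Require Import lra.
Import Order.TTheory GRing.Theory Num.Theory.
Import numFieldNormedType.Exports.
Local Open Scope classical_set_scope.
Local Open Scope ring_scope.

(** Each dual function is Lipschitz, with a constant bounding the [g_i] on the
compact sets [X_i], so it suffices that the disagreement of the multipliers is
summable against [c].  Comparing the proximal step with [ell_i(k)] shows that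
each coordinate of [lambda_i(k+1)] differs from that of [ell_i(k)] by at most
[2 G c(k)]; the coordinates thus evolve independently, each by a perturbed
averaging.  By connectivity a value above the minimum lifts all agents within
[B = m T] steps, so the spread [D] of each coordinate satisfies
[D(k+B) <= (1 - eta^B) D(k) + K c(k)].  Multiplying by [c(k) >= c(k+B)] and
summing, the partial sums [S] of [c D] obey
[S <= (1 - eta^B) S + const + K * \sum_k c(k)^2], hence are bounded. *)

(** * Boundedness of convex functions on compact sets *)

Lemma convex_functionP (R : realType) (V : lmodType R) (h : V -> R) :
  convex_function setT h ->
  forall (t : R) (x y : V), 0 <= t <= 1 ->
    h (t *: x + (1 - t) *: y) <= t * h x + (1 - t) * h y.
Proof.
move=> hc t x y /andP[t0 t1].
by have := hc (Itv01 t0 t1) x y (in_setT _) (in_setT _).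
Qed.

Lemma convex_midpoint (R : realType) (V : lmodType R) (h : V -> R) (x y : V) :
  convex_function setT h -> h (x + y) <= (h (2 *: x) + h (2 *: y)) / 2.
Proof.
move=> /convex_functionP hc.
have half : 0 <= (2^-1 : R) <= 1 by lra.
have := hc _ (2 *: x) (2 *: y) half.
have -> : 1 - 2^-1 = 2^-1 :> R by lra.
by rewrite !scalerA mulVf ?pnatr_eq0 // !scale1r mulrDl ![_ / 2]mulrC.
Qed.

(** Every point of the segment is a convex combination of its endpoints [M *: v] and [(- M) *: v],
    so the absolute values of [h] at these two points add up to a bound. *)
Lemma convex_segment_ubound (R : realType) (V : lmodType R) (h : V -> R)
    (v : V) (M : R) :
  convex_function setT h ->
  exists C, forall t, `|t| <= M -> h (t *: v) <= C.
Proof.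
move=> /convex_functionP hc.
have [M0|M0] := leP M 0.
  exists (h 0) => t tM.
  by move: (le_trans tM M0); rewrite normr_le0 => /eqP ->; rewrite scale0r.
exists (`|h (M *: v)| + `|h ((- M) *: v)|) => t; rewrite ler_norml => /andP[tl tr].
pose s := (t + M) / (2 * M).
have sE : s * (2 * M) = t + M by rewrite /s mulfVK // gt_eqF // mulr_gt0.
have s01 : 0 <= s <= 1.
  by rewrite /s divr_ge0 ?ler_pdivrMr ?mulr_gt0 //=; lra.
have -> : t *: v = s *: (M *: v) + (1 - s) *: ((- M) *: v).
  by rewrite !scalerA -scalerDl; congr (_ *: _); lra.
apply: (le_trans (hc _ _ _ s01)); apply: lerD.
  apply: (le_trans (ler_norm _)); rewrite normrM ler_piMl //.
  by rewrite ger0_norm; lra.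
apply: (le_trans (ler_norm _)); rewrite normrM ler_piMl //.
by rewrite ger0_norm; lra.
Qed.

(** Induction on the number of directions: midpoint convexity splits off one direction but doubles
    the coefficients, which is why [M] is quantified inside the induction. *)
Lemma convex_cube_ubound (R : realType) (V : lmodType R) (I : Type)
    (h : V -> R) (v : I -> V) (s : seq I) :
  convex_function setT h ->
  forall M : R, exists C, forall t : I -> R,
    (forall i, `|t i| <= M) -> h (\sum_(i <- s) t i *: v i) <= C.
Proof.
move=> hc; elim: s => [|i s IH] M.
  by exists (h 0) => t _; rewrite big_nil.
have [C1 C1P] := convex_segment_ubound _ _ _ (v i) (2 * M) hc.
have [C2 C2P] := IH (2 * M).
exists ((C1 + C2) / 2) => t tM; rewrite big_cons.
have t2M j : `|2 * t j| <= 2 * M.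
  by rewrite normrM ger0_norm // ler_pM2l.
apply: (le_trans (convex_midpoint _ _ _ _ _ hc)).
rewrite ler_pM2r ?invr_gt0 // scalerA scaler_sumr.
under eq_bigr do rewrite scalerA.
by apply: lerD; [exact: C1P | exact: (C2P (fun j => 2 * t j))].
Qed.

Lemma convex_compact_bounded (R : realType) (q : nat) (A : set 'rV[R]_q)
    (h : 'rV[R]_q -> R) :
  convex_function setT h -> compact A ->
  exists C, forall x, A x -> `|h x| <= C.
Proof.
move=> hc /compact_bounded [M [_ AM]].
(* [compact_bounded] bounds the norm on [A] only by numbers strictly above [M]. *)
pose N := M + 1.
have AN x : A x -> forall j, `|x ord0 j| <= N.
  move=> Ax j; have : `|x| <= N by apply: AM => //; rewrite /N ltrDl.
  apply: le_trans; rewrite -[leRHS]/(mx_norm x) mx_normrE.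
  exact: (le_bigmax _ (fun ij : 'I_1 * 'I_q => `|x ij.1 ij.2|) (ord0, j)).
have [C CP] := convex_cube_ubound _ _ _ h (fun j : 'I_q => delta_mx ord0 j)
  (index_enum 'I_q) hc N.
have ub (x : 'rV[R]_q) : (forall j, `|x ord0 j| <= N) -> h x <= C.
  by move=> /CP; rewrite -row_sum_delta.
have ub2 (x : 'rV[R]_q) : (forall j, `|x ord0 j| <= N) -> h (- x) <= C.
  by move=> xN; apply: ub => j; rewrite mxE normrN.
(* The cube is symmetric, so [C] also bounds [h (- x)]; then [2 * h 0 <= h x + h (- x)] turns the
   upper bound into the lower bound [2 * h 0 - C <= h x]. *)
exists (`|C| + 2 * `|h 0|) => x /AN xN.
have half : 0 <= (2^-1 : R) <= 1 by lra.
have := convex_functionP _ _ _ hc _ x (- x) half.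
have -> : 2^-1 *: x + (1 - 2^-1) *: - x = 0.
  by rewrite scalerN -scalerBl (_ : _ - _ = 0) ?scale0r //; lra.
have := ub _ xN; have := ub2 _ xN.
have := ler_norm C; have := ler_norm (- h 0).
rewrite ler_norml; have := ler_norm (h 0).
by rewrite normrN => *; apply/andP; split; lra.
Qed.

(** * Weighted averages and the spread of a family *)

Lemma averaging_lbound (R : realType) (m : nat) (w z : 'I_m -> R) (lo : R) :
  (forall j, 0 <= w j) -> \sum_j w j = 1 -> (forall j, lo <= z j) ->
  lo <= \sum_j w j * z j.
Proof.
move=> w0 w1 zlo; rewrite -[leLHS]mul1r -w1 mulr_suml.
by apply: ler_sum => j _; apply: ler_wpM2l.
Qed.

Lemma averaging_ubound (R : realType) (m : nat) (w z : 'I_m -> R) (hi : R) :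
  (forall j, 0 <= w j) -> \sum_j w j = 1 -> (forall j, z j <= hi) ->
  \sum_j w j * z j <= hi.
Proof.
move=> w0 w1 zhi; rewrite -[leRHS]mul1r -w1 mulr_suml.
by apply: ler_sum => j _; apply: ler_wpM2l.
Qed.

(** As the weights sum to 1, [lo] can be subtracted from every [z j]; all terms become nonnegative,
    and the one at [j0] alone gives [eta * d]. *)
Lemma averaging_lbound_gain (R : realType) (m : nat) (w z : 'I_m -> R)
    (lo d eta : R) (j0 : 'I_m) :
  (forall j, 0 <= w j) -> \sum_j w j = 1 -> (forall j, lo <= z j) ->
  0 <= d -> eta <= w j0 -> lo + d <= z j0 ->
  lo + eta * d <= \sum_j w j * z j.
Proof.
move=> w0 w1 zlo d0 eta_w zj0.
rewrite -lerBrDl -[X in _ - X]mul1r -w1 mulr_suml -sumrB.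
under eq_bigr do rewrite -mulrBr.
rewrite (bigD1 j0) //= ler_wpDr //.
  by apply: sumr_ge0 => j _; rewrite mulr_ge0 // subr_ge0.
by apply: (le_trans (ler_wpM2r d0 eta_w)); apply: ler_wpM2l => //; lra.
Qed.

(** The largest value minus the smallest; the default 0 is harmless, since the pairs [(i, i)]
    already contribute 0, and it covers an empty family. *)
Definition spread {R : realType} {m : nat} (z : 'I_m -> R) : R :=
  \big[Num.max/0]_(u : 'I_m * 'I_m) (z u.1 - z u.2).

Lemma spread_ge (R : realType) (m : nat) (z : 'I_m -> R) i j :
  z i - z j <= spread z.
Proof. exact: (le_bigmax 0 (fun u : 'I_m * 'I_m => z u.1 - z u.2) (i, j)). Qed.

Lemma spread_le (R : realType) (m : nat) (z : 'I_m -> R) (D : R) :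
  0 <= D -> (forall i j, z i - z j <= D) -> spread z <= D.
Proof. by move=> D0 zD; apply: bigmax_le => // -[i j] _; exact: zD. Qed.

Lemma spread_ge0 (R : realType) (m : nat) (z : 'I_m -> R) : 0 <= spread z.
Proof. exact: bigmax_ge_id. Qed.

(** Both averages lie between the extreme values of [z]. Serves to compare a row of [a] with the
    uniform weights [1/m]. *)
Lemma averagings_dist (R : realType) (m : nat) (w w' z : 'I_m -> R) :
  (forall j, 0 <= w j) -> \sum_j w j = 1 ->
  (forall j, 0 <= w' j) -> \sum_j w' j = 1 ->
  `|\sum_j w j * z j - \sum_j w' j * z j| <= spread z.
Proof.
have le_spread (w1 w2 : 'I_m -> R) :
    (forall j, 0 <= w1 j) -> \sum_j w1 j = 1 ->
    (forall j, 0 <= w2 j) -> \sum_j w2 j = 1 ->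
    \sum_j w2 j * z j - \sum_j w1 j * z j <= spread z.
  move=> w10 w11 w20 w21; rewrite lerBlDr -lerBlDl.
  apply: averaging_lbound => // j; rewrite lerBlDl.
  apply: averaging_ubound => // i.
  by have := spread_ge _ _ z i j; lra.
move=> w0 w1 w'0 w'1.
by rewrite ler_norml lerNl opprB !le_spread.
Qed.

(** * Perturbed averaging over the network and contraction of the spread *)

Definition perturbed_averaging {R : realType} {m : nat}
    (a : nat -> 'I_m -> 'I_m -> R) (b : nat -> R) (u : nat -> 'I_m -> R) : Prop :=
  forall k i, `|u k.+1 i - \sum_j a k i j * u k j| <= b k.

Lemma perturbed_averagingN (R : realType) (m : nat)
    (a : nat -> 'I_m -> 'I_m -> R) (b : nat -> R) (u : nat -> 'I_m -> R) :
  perturbed_averaging a b u -> perturbed_averaging a b (fun k i => - u k i).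
Proof.
move=> ub k i; under eq_bigr do rewrite mulrN.
by rewrite sumrN -opprD normrN.
Qed.

(** Averaging preserves a lower bound and each of the [t] perturbations costs at most [b k], because
    [b] is nonincreasing. *)
Lemma perturbed_averaging_lbound (R : realType) (m : nat)
    (a : nat -> 'I_m -> 'I_m -> R) (b : nat -> R) (u : nat -> 'I_m -> R)
    (k : nat) (lo : R) :
  (forall k i j, 0 <= a k i j) -> (forall k i, \sum_j a k i j = 1) ->
  nonincreasing_seq b -> perturbed_averaging a b u ->
  (forall i, lo <= u k i) ->
  forall t i, lo - t%:R * b k <= u (k + t)%N i.
Proof.
move=> a0 a1 bmono ub ulo; elim=> [|t IH] i.
  by rewrite mul0r subr0 addn0.
have := averaging_lbound _ _ _ _ _ (a0 (k + t)%N i) (a1 _ _) IH.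
have := ub (k + t)%N i; rewrite ler_norml => /andP[+ _].
have : b (k + t)%N <= b k by apply: bmono; exact: leq_addr.
by rewrite addnS -natr1; lra.
Qed.

(** The gain is measured above the sinking floor [lo - t%:R * b k], which bounds all agents from
    below, so averaging keeps at least the fraction [eta] of it. *)
Lemma perturbed_averaging_gain_step (R : realType) (m : nat)
    (a : nat -> 'I_m -> 'I_m -> R) (b : nat -> R) (u : nat -> 'I_m -> R)
    (k t : nat) (lo d eta : R) (i j : 'I_m) :
  (forall k i j, 0 <= a k i j) -> (forall k i, \sum_j a k i j = 1) ->
  nonincreasing_seq b -> perturbed_averaging a b u ->
  (forall i, lo <= u k i) -> 0 <= d -> 0 <= eta -> eta <= a (k + t)%N i j ->
  lo - t%:R * b k + eta ^+ t * d <= u (k + t)%N j ->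
  lo - t.+1%:R * b k + eta ^+ t.+1 * d <= u (k + t.+1)%N i.
Proof.
move=> a0 a1 bmono ub ulo d0 eta0 eta_a uj.
have lb := perturbed_averaging_lbound _ _ _ _ _ _ _ a0 a1 bmono ub ulo t.
have etad : 0 <= eta ^+ t * d by rewrite mulr_ge0 // exprn_ge0.
have := averaging_lbound_gain _ _ _ _ _ _ _ _ (a0 (k + t)%N i) (a1 _ _) lb
  etad eta_a uj.
have := ub (k + t)%N i; rewrite ler_norml => /andP[+ _].
have : b (k + t)%N <= b k by apply: bmono; exact: leq_addr.
by rewrite addnS -natr1 exprS mulrA; lra.
Qed.

(* A gain at [j] spreads along the edges of E_infinity, each of which is used
   within [T] steps, and is never lost because of the self-weights. *)
Lemma perturbed_averaging_gain (R : realType) (m : nat)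
    (a : nat -> 'I_m -> 'I_m -> R) (b : nat -> R) (u : nat -> 'I_m -> R)
    (k T : nat) (lo d eta : R) (j : 'I_m) :
  (forall k i j, 0 <= a k i j) -> (forall k i, \sum_j a k i j = 1) ->
  (forall k i j, 0 < a k i j -> eta <= a k i j) ->
  0 <= eta -> (forall k i, eta <= a k i i) ->
  (forall j i, connect [rel u v | `[< edge_inf a u v >]] j i) ->
  (forall j i, edge_inf a j i ->
     forall k, exists2 s, (k <= s < k + T)%N & edge a s j i) ->
  nonincreasing_seq b -> perturbed_averaging a b u ->
  (forall i, lo <= u k i) -> 0 <= d -> lo + d <= u k j ->
  forall i, lo - (m * T)%:R * b k + eta ^+ (m * T) * d <= u (k + m * T)%N i.
Proof.
move=> a0 a1 aeta eta0 adiag conn per bmono ub ulo d0 uj.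
pose P t i := lo - t%:R * b k + eta ^+ t * d <= u (k + t)%N i.
have Pstep t i i' : eta <= a (k + t)%N i i' -> P t i' -> P t.+1 i.
  exact: perturbed_averaging_gain_step.
have Pmono t s i : (t <= s)%N -> P t i -> P s i.
  move=> /subnKC <-; elim: (s - t)%N => [|r IH] Pt; first by rewrite addn0.
  by rewrite addnS; apply: Pstep (IH Pt).
have Pedge t i i' : edge_inf a i i' -> P t i -> P (t + T)%N i'.
  move=> /per /(_ (k + t)%N) [s /andP[ks skT] e] Pt.
  have sE : s = (k + (s - k))%N by rewrite subnKC // (leq_trans _ ks) ?leq_addr.
  apply: (Pmono (s - k).+1).
    by rewrite -(ltn_add2l k) -sE addnA.
  apply: (Pstep _ _ i); first by rewrite -sE; exact: aeta.
  by apply: Pmono Pt; rewrite leq_subRL // (leq_trans _ ks) ?leq_addr.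
have Ppath p t i : path [rel u v | `[< edge_inf a u v >]] i p ->
    P t i -> P (t + size p * T)%N (last i p).
  elim: p t i => [|i' p IH] t i /=; first by rewrite mul0n addn0.
  move=> /andP[/asboolP e pp] Pt; rewrite mulSn addnA.
  exact: IH pp (Pedge _ _ _ e Pt).
move=> i; have /connectP[p pp ->] := conn j i.
(* A path without repeated vertices visits at most [m] agents, so its length times [T] fits within
   [m * T] steps. *)
case/shortenP: pp => p' pp' up' _.
have P0 : P 0%N j by rewrite /P mul0r subr0 mul1r addn0.
apply: Pmono (Ppath _ _ _ pp' P0); rewrite add0n leq_mul2r ltnW ?orbT //.
by have := max_card (mem (j :: p')); rewrite (card_uniqP up') card_ord.
Qed.

(** The gain of the maximal agent over the minimum raises every agent after [m * T] steps, while the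
    maximum, bounded by applying the lower bound to [- u], rises only by the perturbations. Each
    side loses [(m * T)%:R * b k], hence the factor 2. *)
Lemma spread_contraction (R : realType) (m : nat)
    (a : nat -> 'I_m -> 'I_m -> R) (b : nat -> R) (u : nat -> 'I_m -> R)
    (k T : nat) (eta : R) :
  (forall k i j, 0 <= a k i j) -> (forall k i, \sum_j a k i j = 1) ->
  (forall k i j, 0 < a k i j -> eta <= a k i j) ->
  0 <= eta <= 1 -> (forall k i, eta <= a k i i) ->
  (forall j i, connect [rel u v | `[< edge_inf a u v >]] j i) ->
  (forall j i, edge_inf a j i ->
     forall k, exists2 s, (k <= s < k + T)%N & edge a s j i) ->
  nonincreasing_seq b -> 0 <= b k -> perturbed_averaging a b u ->
  spread (u (k + m * T)%N) <=
    (1 - eta ^+ (m * T)) * spread (u k) + 2 * (m * T)%:R * b k.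
Proof.
move=> a0 a1 aeta /andP[eta0 eta1] adiag conn per bmono bk0 ub.
have rho0 : 0 <= 1 - eta ^+ (m * T) by rewrite subr_ge0 exprn_ile1.
apply: spread_le => [|i i'].
  by rewrite addr_ge0 ?mulr_ge0 ?spread_ge0.
case: (arg_minP (u k) (erefl : xpredT i)) => jm _ jmP.
case: (arg_maxP (u k) (erefl : xpredT i)) => jM _ jMP.
have lo j : u k jm <= u k j by exact: jmP.
have hi j : - u k jM <= - u k j by rewrite lerN2; exact: jMP.
have d0 : 0 <= u k jM - u k jm by rewrite subr_ge0.
have d1 : u k jm + (u k jM - u k jm) <= u k jM by rewrite subrKC.
have low := perturbed_averaging_gain _ _ _ _ _ _ _ _ _ _ _
  a0 a1 aeta eta0 adiag conn per bmono ub lo d0 d1 i'.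
have upp := perturbed_averaging_lbound _ _ _ _ _ _ _ a0 a1 bmono
  (perturbed_averagingN _ _ _ _ _ ub) hi (m * T)%N i.
have : (1 - eta ^+ (m * T)) * (u k jM - u k jm) <=
       (1 - eta ^+ (m * T)) * spread (u k).
  by apply: ler_wpM2l => //; exact: spread_ge.
by rewrite /= in low upp *; lra.
Qed.

(** * Summability against the coefficients *)

Lemma weighted_sum_bounded (R : realType) (c D : nat -> R) (B : nat)
    (rho K M : R) :
  nonincreasing_seq c -> (forall k, 0 <= c k) -> (forall k, 0 <= D k) ->
  0 <= rho < 1 -> 0 <= K ->
  (forall k, D (k + B)%N <= rho * D k + K * c k) ->
  (forall N, \sum_(0 <= k < N) c k ^+ 2 <= M) ->
  exists C, forall N, \sum_(0 <= k < N) c k * D k <= C.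
Proof.
move=> cmono c0 D0 /andP[rho0 rho1] K0 DB cM.
exists ((\sum_(0 <= k < B) c k * D k + K * M) / (1 - rho)) => N.
have cD0 k : 0 <= c k * D k by rewrite mulr_ge0.
rewrite ler_pdivlMr ?subr_gt0 //.
have le1 : \sum_(0 <= k < N) c k * D k <= \sum_(0 <= k < B + N) c k * D k.
  rewrite addnC (big_cat_nat (leq0n N) (leq_addr B N)) /= lerDl.
  by apply: sumr_ge0.
have le2 : \sum_(B <= k < B + N) c k * D k <=
    rho * \sum_(0 <= k < N) c k * D k + K * \sum_(0 <= k < N) c k ^+ 2.
  rewrite -{1}[B]add0n [(B + N)%N]addnC big_addn addnK.
  rewrite !mulr_sumr -big_split /=; apply: ler_sum => k _.
  (* Monotonicity of [c] replaces [c (k + B)] by [c k], so that the recursion for [D] can be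
     multiplied by [c k]. *)
  apply: (@le_trans _ _ (c k * D (k + B)%N)).
    by apply: ler_wpM2r => //; apply: cmono; exact: leq_addr.
  by have := ler_wpM2l (c0 k) (DB k); rewrite expr2; lra.
have := ler_wpM2l K0 (cM N).
move: le1; rewrite (big_cat_nat (leq0n B) (leq_addr N B)) //=.
by move: le2; lra.
Qed.

Lemma nneseries_ltP (R : realType) (u : nat -> R) (n : nat) :
  (forall k, 0 <= u k) ->
  (\sum_(n <= k <oo) (u k)%:E < +oo)%E <->
  exists C, forall N, \sum_(n <= k < N) u k <= C.
Proof.
move=> u0.
have uE0 k : (n <= k)%N -> xpredT k -> (0 <= (u k)%:E)%E by rewrite lee_fin.
split=> [fin|[C uC]].
  have fn : (\sum_(n <= k <oo) (u k)%:E)%E \is a fin_num.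
    by rewrite ge0_fin_numE // nneseries_ge0.
  exists (fine (\sum_(n <= k <oo) (u k)%:E)%E) => N.
  by rewrite -lee_fin fineK // -sumEFin; exact: nneseries_lim_ge.
apply: (@le_lt_trans _ _ C%:E); last exact: ltry.
apply: lime_le; first exact: is_cvg_nneseries.
by apply: nearW => N; rewrite sumEFin lee_fin.
Qed.

(** * Dual functions and the proximal step *)

(** A minimizer is assumed at [l] only: the algorithm supplies one at [ell], none at the average.
    Its value minus [K] bounds the Lagrangian at [l'] from below, so the infimum there is a genuine
    one. *)
Lemma dual_fun_dist (R : realType) (q p : nat) (X : set 'rV[R]_q)
    (f : 'rV[R]_q -> R) (g : 'rV[R]_q -> 'rV[R]_p) (l l' : 'rV[R]_p)
    (x0 : 'rV[R]_q) (K : R) :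
  argmin X (lagrangian f g l) x0 ->
  (forall x, X x -> `|dot l (g x) - dot l' (g x)| <= K) ->
  `|dual_fun X f g l - dual_fun X f g l'| <= K.
Proof.
move=> x0min lK; rewrite (dual_fun_min x0min).
have [Xx0 {}x0min] := x0min.
have lb x : X x -> lagrangian f g l x0 - K <= lagrangian f g l' x.
  move=> Xx; have := x0min _ Xx; have := lK _ Xx.
  by rewrite /lagrangian ler_norml => /andP[_ +]; lra.
have low : lagrangian f g l x0 - K <= dual_fun X f g l'.
  apply: lb_le_inf; first by exists (lagrangian f g l' x0); exists x0.
  by move=> _ [x Xx <-]; exact: lb.
have upp : dual_fun X f g l' <= lagrangian f g l' x0.
  apply: ge_inf; last by exists x0.
  by exists (lagrangian f g l x0 - K) => _ [x Xx <-]; exact: lb.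
have := lK _ Xx0; move: low upp; rewrite /lagrangian !ler_norml.
by move=> low upp /andP[? ?]; apply/andP; split; lra.
Qed.

Lemma enorm_sqr (R : realType) (q : nat) (v : 'rV[R]_q) :
  enorm v ^+ 2 = \sum_(j < q) v ord0 j ^+ 2.
Proof.
rewrite /enorm sqr_sqrtr; last first.
  by apply: sumr_ge0 => j _; rewrite -expr2 sqr_ge0.
by apply: eq_bigr => j _; rewrite expr2.
Qed.

(* The objective is separable, so [l] may be tested against the point that
   differs from it only in coordinate [j], where it takes the value of [l0]. *)
Lemma proximal_step_dist (R : realType) (p : nat) (v l l0 : 'rV[R]_p) (c : R) :
  0 < c -> nneg_orthant l0 ->
  argmax (@nneg_orthant R p)
    (fun l => dot v l - (2 * c)^-1 * enorm (l - l0) ^+ 2) l ->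
  forall j, `|l ord0 j - l0 ord0 j| <= 2 * c * `|v ord0 j|.
Proof.
move=> c0 l0_ge0 [l_ge0 lmax] j.
pose F (h : 'rV[R]_p) i :=
  v ord0 i * h ord0 i - (2 * c)^-1 * (h ord0 i - l0 ord0 i) ^+ 2.
have FE h : dot v h - (2 * c)^-1 * enorm (h - l0) ^+ 2 = \sum_i F h i.
  rewrite enorm_sqr mulr_sumr -sumrB; apply: eq_bigr => i _.
  by rewrite !mxE.
pose l' : 'rV[R]_p := \row_i (if i == j then l0 ord0 i else l ord0 i).
have l'_ge0 : nneg_orthant l'.
  by move=> i; rewrite mxE; case: ifP => _; [exact: l0_ge0|exact: l_ge0].
have := lmax _ l'_ge0; rewrite !FE (bigD1 j) //= [leRHS](bigD1 j) //=.
have -> : \sum_(i | i != j) F l' i = \sum_(i | i != j) F l i.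
  by apply: eq_bigr => i /negPf ij; rewrite /F mxE ij.
rewrite lerD2r /F mxE eqxx subrr expr0n /= mulr0 subr0.
set d := l ord0 j - l0 ord0 j => h.
have {}h : (2 * c)^-1 * d ^+ 2 <= v ord0 j * d by rewrite /d mulrBr in h *; lra.
have c20 : 0 < 2 * c by rewrite mulr_gt0.
rewrite ler_pdivrMl // in h.
(* The comparison gave [d ^+ 2 <= 2 * c * (v ord0 j * d)]; for nonzero [d], divide by its absolute
   value. *)
have [->|d0] := eqVneq d 0; first by rewrite normr0 mulr_ge0 // ltW.
rewrite -(ler_pM2r (_ : 0 < `|d|)) ?normr_gt0 //.
rewrite -normrM -expr2 ger0_norm ?sqr_ge0 //.
apply: (le_trans h); rewrite -[leRHS]mulrA -normrM ler_pM2l //.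
exact: ler_norm.
Qed.

Theorem mainTheorem3 (R : realType) (m p : nat) (n : 'I_m -> nat)
    (X : forall i : 'I_m, set 'rV[R]_(n i))
    (f : forall i : 'I_m, 'rV[R]_(n i) -> R)
    (g : forall i : 'I_m, 'rV[R]_(n i) -> 'rV[R]_p)
    (a : nat -> 'I_m -> 'I_m -> R) (c : nat -> R)
    (x xhat : nat -> forall i : 'I_m, 'rV[R]_(n i))
    (lam : nat -> 'I_m -> 'rV[R]_p)
    (hconvex : convexity_assumption X f g)
    (hcompact : compactness_assumption X)
    (hslater : slater_assumption X g)
    (hcoef : coefficient_assumption c)
    (hweights : weights_assumption a)
    (hconnect : connectivity_assumption a)
    (hrun : algorithm_run X f g a c x xhat lam) :
  (\sum_(1 <= k <oo)
     (c k * \sum_(i < m)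
        `| dual_fun (X i) (f i) (g i) (ell a lam k i)
           - dual_fun (X i) (f i) (g i) (average lam k) |)%:E < +oo)%E.
Proof.
have [cmono c_gt0 _ c2fin] := hcoef.
have c_ge0 k : 0 <= c k by exact: ltW.
have [M c2M] : exists M, forall N, \sum_(0 <= k < N) c k ^+ 2 <= M.
  by apply/nneseries_ltP => // k; exact: sqr_ge0.
have [[eta [/andP[eta0 eta1] aP]] asum] := hweights.
have a_ge0 k i j : 0 <= a k i j by have [/andP[]] := aP i j k.
have a_sum1 k i : \sum_j a k i j = 1 by have [] := asum k.
have a_eta k i j : 0 < a k i j -> eta <= a k i j by have [] := aP i j k.
have a_diag k i : eta <= a k i i by have [] := aP i i k.
have [conn [T _ per]] := hconnect.
have [xhat_lam0 runP] := hrun.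
have /choice[G0 G0P] : forall u : 'I_m * 'I_p, exists C, forall y,
    X u.1 y -> `|g u.1 y ord0 u.2| <= C.
  move=> [i j] /=; have [_ gconv _] := hconvex i.
  exact: convex_compact_bounded (gconv j) (hcompact i).
(* Summing over all agents and coordinates gives one constant that dominates every individual
   bound. *)
pose G := \sum_u `|G0 u|.
have G_ge0 : 0 <= G by apply: sumr_ge0.
have gG i y j : X i y -> `|g i y ord0 j| <= G.
  move=> Xy; apply: (le_trans (G0P (i, j) y Xy)).
  rewrite /G (bigD1 (i, j)) //=; apply: (le_trans (ler_norm _)).
  by rewrite lerDl sumr_ge0.
have lam_ge0 k i : nneg_orthant (lam k i).
  case: k => [|k]; first by have [] := xhat_lam0 i.
  by have [_ []] := runP k i.
have ellE k i j : ell a lam k i ord0 j = \sum_i' a k i i' * lam k i' ord0 j.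
  by rewrite /ell summxE; apply: eq_bigr => i' _; rewrite mxE.
have ell_ge0 k i : nneg_orthant (ell a lam k i).
  move=> j; rewrite ellE; apply: sumr_ge0 => i' _.
  by rewrite mulr_ge0 //; exact: lam_ge0.
pose b k := 2 * G * c k.
have b_ge0 k : 0 <= b k by rewrite !mulr_ge0.
have bmono : nonincreasing_seq b.
  by move=> k k' kk'; apply: ler_wpM2l; [rewrite mulr_ge0|exact: cmono].
pose u (j : 'I_p) k i := lam k i ord0 j.
have ub j : perturbed_averaging a b (u j).
  move=> k i; rewrite /u -ellE; have [[Xx _] lmax _] := runP k i.
  apply: (le_trans (proximal_step_dist _ _ _ _ _ _ (c_gt0 k) (ell_ge0 k i) lmax j)).
  rewrite /b mulrAC; apply: ler_wpM2r => //; apply: ler_wpM2l => //.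
  exact: gG.
have etaB_gt0 : 0 < eta ^+ (m * T) by exact: exprn_gt0.
have etaB_le1 : eta ^+ (m * T) <= 1 by rewrite exprn_ile1 // ltW.
(* With [b k = 2 * G * c k], the contraction over [m * T] steps is the recursion of
   [weighted_sum_bounded]; its factor is below 1 because [eta] is positive. *)
have /choice[S SP] : forall j, exists C, forall N,
    \sum_(0 <= k < N) c k * spread (u j k) <= C.
  move=> j; apply: (weighted_sum_bounded _ _ _ (m * T) (1 - eta ^+ (m * T))
    (2 * (m * T)%:R * (2 * G)) M) => //.
  - by move=> k; exact: spread_ge0.
  - by rewrite subr_ge0 etaB_le1 ltrBlDr ltrDl.
  - by rewrite !mulr_ge0.
  - move=> k; rewrite -[_ * c k]mulrA.
    apply: (spread_contraction _ _ a b (u j) k T eta) => //.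
    by rewrite !ltW.
have ell_avg k i j :
    `|ell a lam k i ord0 j - average lam k ord0 j| <= spread (u j k).
  (* The agent [i] itself witnesses that [m] is positive. *)
  have m_neq0 : m%:R != 0 :> R.
    by rewrite pnatr_eq0 -lt0n (leq_ltn_trans _ (ltn_ord i)).
  have -> : average lam k ord0 j = \sum_i' m%:R^-1 * u j k i'.
    by rewrite /average mxE summxE mulr_sumr.
  rewrite ellE; apply: averagings_dist => //.
  by rewrite sumr_const card_ord -[LHS]mulr_natr mulVf.
have dual_dist k i :
    `| dual_fun (X i) (f i) (g i) (ell a lam k i)
       - dual_fun (X i) (f i) (g i) (average lam k) |
    <= G * \sum_j spread (u j k).
  have [xmin _ _] := runP k i; apply: (dual_fun_dist _ _ _ _ _ _ _ _ _ _ xmin) => y Xy.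
  rewrite /dot -sumrB mulr_sumr; apply: (le_trans (ler_norm_sum _ _ _)).
  apply: ler_sum => j _; rewrite -mulrBl normrM mulrC.
  by apply: ler_pM => //; exact: gG.
apply/nneseries_ltP.
  by move=> k; rewrite mulr_ge0 // sumr_ge0.
(* [m] counts the agents, [G] is the Lipschitz constant of each dual function for the sum of
   coordinate distances, and [S j] bounds the weighted spreads of coordinate [j]. *)
exists (m%:R * G * \sum_j S j) => N.
apply: (@le_trans _ _ (\sum_(0 <= k < N) m%:R * G * \sum_j c k * spread (u j k))).
  (* The series starts at 1 but the bounds [S] concern sums from 0; the extra term at 0 is
     nonnegative. *)
  case: N => [|N]; first by rewrite !big_geq.
  rewrite [leRHS]big_ltn // -[leLHS]add0r; apply: lerD.
    rewrite !mulr_ge0 // sumr_ge0 // => j _.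
    by rewrite mulr_ge0 // spread_ge0.
  apply: ler_sum => k _; rewrite -mulr_sumr mulrCA; apply: ler_wpM2l => //.
  apply: (@le_trans _ _ (\sum_(i < m) G * \sum_j spread (u j k))).
    by apply: ler_sum => i _; exact: dual_dist.
  by rewrite sumr_const card_ord -[leLHS]mulr_natl mulrA.
rewrite -mulr_sumr; apply: ler_wpM2l; first by rewrite mulr_ge0.
by rewrite exchange_big /=; apply: ler_sum => j _; exact: SP.
Qed.
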